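(* Consider the iterative averaging method described in the context, in the noiseless case $Y_i=X_i\beta$, $i=1,\dots,k$. If at least one $X_i^\top X_i$ has (strictly) positive eigenvalues, then the iterates converge to the true coefficients geometrically, $\hat\beta^t\to\beta$ as $t\to\infty$, and for all $t\geq 0$ $$\|\hat\beta^t-\beta\|_2\le\lambda_{\max}\left(\frac1k\sum_{i=1}^kn_i\rho_i\,(X_i^\top X_i+n_i\rho_iI)^{-1}\right)^t\cdot\|\beta\|_2.$$
   Context: For $i=1,\dots,k$, $X_i$ is an $n_i\times p$ real matrix, $Y_i\in\mathbb{R}^{n_i}$, and $\beta\in\mathbb{R}^p$. Iterative averaging method. Given regularization parameters $\rho_i\ge0$ such that all matrices $X_i^\top X_i+n_i\rho_iI$ are invertible, set $\hat\beta^0=0$ and for $t\ge0$ $$\hat\beta_i^{t+1}=(X_i^\top X_i+n_i\rho_iI)^{-1}(X_i^\top Y_i+n_i\rho_i\hat\beta^t),\qquad \hat\beta^{t+1}=\frac1k\sum_{i=1}^k\hat\beta_i^{t+1}.$$ $\lambda_{\max}$ denotes the largest eigenvalue. ''Geometric'' convergence means that the displayed $\lambda_{\max}$ is strictly less than 1. *)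

(* Defs.v *)
From HB Require Import structures.
From mathcomp Require Import all_boot all_order all_algebra.
From mathcomp Require Import all_classical all_reals all_analysis.

Set Implicit Arguments.
Unset Strict Implicit.
Unset Printing Implicit Defensive.

Import Order.TTheory GRing.Theory Num.Theory.
Import numFieldNormedType.Exports.

Local Open Scope classical_set_scope.
Local Open Scope ring_scope.

(* The norm that MathComp-Analysis puts on matrices is the sup norm, hence
   this explicit Euclidean norm. *)
Definition norm2 (R : realType) (p : nat) (v : 'cV[R]_p) : R :=
  Num.sqrt (\sum_(j < p) v j 0 ^+ 2).

(* Junk value 0 when A has no real eigenvalue; otherwise the supremum is
   attained, see lambda_max_largest. *)
Definition lambda_max (R : realType) (p : nat) (A : 'M[R]_p) : R :=
  sup [set a : R | eigenvalue A a].

Lemma largest_root (R : realType) (q : {poly R}) :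
  q != 0 -> (exists a, root q a) ->
  exists2 m, root q m & forall a, root q a -> a <= m.
Proof.
have [n] := ubnP (size q); elim: n q => // n IHn q szq q0 [a].
move=> /factor_theorem [r qE].
have r0 : r != 0 by apply: contraNneq q0 => r0; rewrite qE r0 mul0r.
have rootE x : root q x = root r x || (x == a).
  by rewrite qE rootM root_XsubC.
have szr : (size r < n)%N.
  by move: szq; rewrite qE size_Mmonic ?monicXsubC// size_XsubC addn2.
have [r_root|r_noroot] := pselect (exists b, root r b).
  have [m rm mP] := IHn r szr r0 r_root.
  exists (Num.max m a).
    by rewrite rootE; case: (leP m a) => _; rewrite ?rm ?eqxx ?orbT.
  by move=> x; rewrite rootE le_max => /orP[/mP ->//|/eqP ->]; rewrite lexx orbT.
exists a; first by rewrite rootE eqxx orbT.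
by move=> x; rewrite rootE => /orP[rx|/eqP ->//]; case: r_noroot; exists x.
Qed.

Lemma lambda_max_largest (R : realType) (p : nat) (A : 'M[R]_p) :
  (exists a, eigenvalue A a) ->
  eigenvalue A (lambda_max A) /\
  (forall a, eigenvalue A a -> a <= lambda_max A).
Proof.
move=> [a Aa].
have [|m] := largest_root (monic_neq0 (char_poly_monic A)).
  by exists a; rewrite -eigenvalue_root_char.
rewrite -eigenvalue_root_char => Am mP.
have Am_max x : eigenvalue A x -> x <= m.
  by rewrite eigenvalue_root_char; exact: mP.
suff -> : lambda_max A = m by [].
apply/eqP; rewrite eq_le; apply/andP; split.
  by apply: ge_sup; [exists m | exact: Am_max].
by apply: ub_le_sup => //; exists m; exact: Am_max.
Qed.

Definition reg_gram (R : realType) (m p : nat) (X : 'M[R]_(m, p)) (rho : R) :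
    'M[R]_p :=
  X^T *m X + (m%:R * rho)%:M.

Definition local_update (R : realType) (m p : nat) (X : 'M[R]_(m, p))
    (Y : 'cV[R]_m) (rho : R) (b : 'cV[R]_p) : 'cV[R]_p :=
  invmx (reg_gram X rho) *m (X^T *m Y + (m%:R * rho) *: b).

Definition averaged_update (R : realType) (k p : nat) (n : 'I_k -> nat)
    (X : forall i, 'M[R]_(n i, p)) (Y : forall i, 'cV[R]_(n i))
    (rho : 'I_k -> R) (b : 'cV[R]_p) : 'cV[R]_p :=
  k%:R^-1 *: \sum_(i < k) local_update (X i) (Y i) (rho i) b.

Definition beta_hat (R : realType) (k p : nat) (n : 'I_k -> nat)
    (X : forall i, 'M[R]_(n i, p)) (Y : forall i, 'cV[R]_(n i))
    (rho : 'I_k -> R) (t : nat) : 'cV[R]_p :=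
  iter t (averaged_update X Y rho) 0.

Definition contraction_mx (R : realType) (k p : nat) (n : 'I_k -> nat)
    (X : forall i, 'M[R]_(n i, p)) (rho : 'I_k -> R) : 'M[R]_p :=
  k%:R^-1 *: \sum_(i < k)
    ((n i)%:R * rho i) *: invmx (reg_gram (X i) (rho i)).

(* Main.v *)
(* The error obeys [beta_hat (t+1) - beta = C (beta_hat t - beta)], where [C] is
   the average of the matrices [c_i G_i^-1], [G_i = X_i^T X_i + c_i I] and
   [c_i = n_i rho_i].  Writing [u = G_i w], one has
   [|u|^2 - <u, c_i G_i^-1 u> = |X_i^T X_i w|^2 + c_i |X_i w|^2 >= 0], strictly
   for [u != 0] when [X_i^T X_i] is positive definite; hence every eigenvalue of
   [C] is below 1.  As [C] is symmetric positive semidefinite, the maximum of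
   its Rayleigh quotient on the compact unit sphere is an eigenvalue, and it
   bounds the operator norm of [C]. *)
Require Import Defs.
From HB Require Import structures.
From mathcomp Require Import all_boot all_order all_algebra.
From mathcomp Require Import all_classical all_reals all_analysis.
From mathcomp Require Import ring lra.

Set Implicit Arguments.
Unset Strict Implicit.
Unset Printing Implicit Defensive.

Import Order.TTheory GRing.Theory Num.Theory.
Import numFieldNormedType.Exports.

Local Open Scope classical_set_scope.
Local Open Scope ring_scope.

(** * Euclidean inner product, and comparison of [norm2] with the sup norm *)

Definition dot (R : pzRingType) (p : nat) (u v : 'cV[R]_p) : R :=
  (u^T *m v) 0 0.

Section Dot.
Variables (R : realType) (p : nat).
Implicit Types (u v w : 'cV[R]_p) (M : 'M[R]_p) (a : R).

Lemma dotE u v : dot u v = \sum_j u j 0 * v j 0.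
Proof. by rewrite /dot mxE; apply: eq_bigr => j _; rewrite mxE. Qed.

Lemma dotC u v : dot u v = dot v u.
Proof. by rewrite !dotE; apply: eq_bigr => j _; rewrite mulrC. Qed.

Lemma dotDr u v w : dot u (v + w) = dot u v + dot u w.
Proof. by rewrite /dot mulmxDr mxE. Qed.

Lemma dotBr u v w : dot u (v - w) = dot u v - dot u w.
Proof. by rewrite /dot mulmxBr !mxE. Qed.

Lemma dotZr a u v : dot u (a *: v) = a * dot u v.
Proof. by rewrite /dot -scalemxAr mxE. Qed.

Lemma dotDl u v w : dot (u + v) w = dot u w + dot v w.
Proof. by rewrite dotC dotDr !(dotC w). Qed.

Lemma dotBl u v w : dot (u - v) w = dot u w - dot v w.
Proof. by rewrite dotC dotBr !(dotC w). Qed.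

Lemma dotZl a u v : dot (a *: u) v = a * dot u v.
Proof. by rewrite dotC dotZr dotC. Qed.

Lemma dot_sumr (I : finType) u (F : I -> 'cV[R]_p) :
  dot u (\sum_i F i) = \sum_i dot u (F i).
Proof. by rewrite /dot mulmx_sumr summxE. Qed.

Lemma dot_ge0 u : 0 <= dot u u.
Proof. by rewrite dotE sumr_ge0// => j _; rewrite -expr2 sqr_ge0. Qed.

Lemma dot_eq0 u : (dot u u == 0) = (u == 0).
Proof.
apply/eqP/eqP => [|->]; last by rewrite /dot mulmx0 mxE.
rewrite dotE => /eqP; rewrite psumr_eq0 => [/allP u0|j _]; last first.
  by rewrite -expr2 sqr_ge0.
apply/colP => j; rewrite mxE; apply/eqP.
by have := u0 j (mem_index_enum _); rewrite mulf_eq0 orbb.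
Qed.

Lemma dot_gt0 u : u != 0 -> 0 < dot u u.
Proof. by move=> u0; rewrite lt_def dot_eq0 u0 dot_ge0. Qed.

Lemma norm2E u : norm2 u = Num.sqrt (dot u u).
Proof.
by rewrite /norm2 dotE; congr Num.sqrt; apply: eq_bigr => j _; rewrite expr2.
Qed.

End Dot.

Lemma dot_mulmxr (R : realType) (m p : nat) (A : 'M[R]_(m, p))
    (u : 'cV[R]_m) (v : 'cV[R]_p) :
  dot u (A *m v) = dot (A^T *m u) v.
Proof. by rewrite /dot trmx_mul trmxK mulmxA. Qed.

Lemma coord_le_norm2 (R : realType) (p : nat) (v : 'cV[R]_p) j :
  `|v j 0| <= norm2 v.
Proof.
rewrite -sqrtr_sqr ler_wsqrtr// (bigD1 j)//= lerDl sumr_ge0// => l _.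
exact: sqr_ge0.
Qed.

(** Convergence of matrices is measured in the sup norm, so this turns a [norm2] bound into
    convergence. *)
Lemma normr_le_norm2 (R : realType) (p : nat) (v : 'cV[R]_p) : `|v| <= norm2 v.
Proof.
change (mx_norm v <= norm2 v).
have [->|/mx_norm_neq0[[i j] ->]] := eqVneq (mx_norm v) 0; first exact: sqrtr_ge0.
by rewrite (ord1 j) coord_le_norm2.
Qed.

(** [eigenvalue] refers to row eigenvectors; transposing gives access to column eigenvectors, which
    suit [dot]. *)
Lemma eigenvalue_tr (F : fieldType) (p : nat) (M : 'M[F]_p) (a : F) :
  eigenvalue M^T a <-> exists2 u : 'cV[F]_p, M *m u = a *: u & u != 0.
Proof.
split=> [/eigenvalueP[u Mu u0]|[u Mu u0]]; last first.
  apply/eigenvalueP; exists u^T; last by rewrite trmx_eq0.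
  by rewrite -trmx_mul Mu linearZ.
exists u^T; last by rewrite trmx_eq0.
by rewrite -[M]trmxK -trmx_mul Mu linearZ.
Qed.

Definition possemidef (R : realType) (p : nat) (M : 'M[R]_p) :=
  forall v : 'cV[R]_p, 0 <= dot v (M *m v).

(** * Rayleigh quotients of symmetric matrices *)

Section Rayleigh.
Variables (R : realType) (p : nat).
Implicit Types (u v : 'cV[R]_p) (M : 'M[R]_p).

(** The variable is a row because [bounded_closed_compact] concerns sets of row vectors. *)
Lemma continuous_quadratic M :
  continuous (fun x : 'rV[R]_p => dot x^T (M *m x^T)).
Proof.
rewrite (_ : (fun x => _) =
    (fun x : 'rV[R]_p => \sum_i x 0 i * \sum_j M i j * x 0 j)); last first.
  apply/funext => x; rewrite dotE; apply: eq_bigr => i _; rewrite !mxE.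
  by congr (_ * _); apply: eq_bigr => j _; rewrite mxE.
apply: continuous_big => [|i _ x]; first exact: add_continuous.
apply: continuousM; first exact: coord_continuous.
move: x; apply: continuous_big => [|j _ x]; first exact: add_continuous.
apply: (@continuousM _ _ (fun=> M i j)); last exact: coord_continuous.
exact: cst_continuous.
Qed.

Lemma compact_sphere : compact [set x : 'rV[R]_p | dot x^T x^T = 1].
Proof.
apply: bounded_closed_compact.
  exists 1; split => // r r1 x /= x1; apply: (le_trans _ (ltW r1)).
  change (mx_norm x <= 1).
  have [->//|/mx_norm_neq0[[i j] ->]] := eqVneq (mx_norm x) 0.
  rewrite /= (ord1 i) -[leRHS]sqrtr1 -x1 -norm2E.
  by have := coord_le_norm2 x^T j; rewrite mxE.
(* Closedness: the sphere is the preimage of 1 under the quadratic form of the identity. *)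
rewrite (_ : [set _ | _] =
    (fun x : 'rV[R]_p => dot x^T (1%:M *m x^T)) @^-1` [set 1]).
  apply: closed_comp => [x _|]; first exact: continuous_quadratic.
  exact: closed_eq.
by apply/seteqP; split=> x /=; rewrite mul1mx.
Qed.

Lemma rayleigh_max M : (0 < p)%N ->
  exists u, [/\ u != 0 & possemidef ((dot u (M *m u) / dot u u)%:M - M)].
Proof.
move=> p0; pose j0 := Ordinal p0.
have [|u] := compact_EVT_max _ compact_sphere
    (continuous_subspaceT (@continuous_quadratic M)).
  (* The sphere is nonempty: it contains a basis vector, available since [0 < p]. *)
  exists (delta_mx 0 j0) => /=; rewrite trmx_delta dotE (bigD1 j0)//= big1 ?addr0.
    by rewrite !mxE !eqxx mulr1.
  by move=> j /negPf jj0; rewrite mxE jj0 mul0r.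
rewrite inE /= => u1 umax; have u0 : u^T != 0.
  by rewrite -dot_eq0 u1 oner_eq0.
exists u^T; split=> // v; rewrite u1 divr1.
have [->|v0] := eqVneq v 0; first by rewrite mulmx0 /dot mulmx0 mxE.
have vv := dot_gt0 v0; set s := Num.sqrt (dot v v).
have s0 : 0 < s by rewrite sqrtr_gt0.
have s2 : s ^+ 2 = dot v v by rewrite sqr_sqrtr// ltW.
(* Maximality over the sphere extends to every nonzero [v] by normalizing it; the form is
   homogeneous of degree 2. *)
have := umax (s^-1 *: v^T); rewrite inE /= linearZ /= trmxK -scalemxAr.
rewrite !dotZl !dotZr => /(_ _); rewrite !mulrA -!expr2 -s2.
have -> : s^-1 ^+ 2 * s ^+ 2 = 1 by rewrite -exprMn mulVf ?expr1n// gt_eqF.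
move=> /(_ erefl); rewrite exprVn mulrC ler_pdivrMr ?exprn_gt0// => le.
by rewrite mulmxBl mul_scalar_mx dotBr dotZr -s2 subr_ge0.
Qed.

(* Expand the quadratic form of [M] at [K v - M v]. *)
Lemma possemidef_sqr_le M (K : R) v : M^T = M -> possemidef M -> possemidef (K%:M - M) ->
  0 < K -> dot (M *m v) (M *m v) <= K * dot v (M *m v).
Proof.
move=> Msym M0 MK K0; have := M0 (K *: v - M *m v); have := MK (M *m v).
rewrite mulmxBr -scalemxAr mulmxBl mul_scalar_mx.
rewrite !(dotBl, dotBr, dotZl, dotZr).
rewrite (dot_mulmxr _ v (M *m v)) Msym.
set a := dot (M *m v) (M *m v); set b := dot v _; set c := dot (M *m v) _.
move=> h1 h2; rewrite -(ler_pM2l K0); nra.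
Qed.

(** At a maximizer [u] of the Rayleigh quotient, the form of [N = m%:M - M] vanishes. As [N] is
    positive semidefinite, [possemidef_sqr_le] forces [N *m u = 0]. *)
Lemma rayleigh_eigenvalue M : (0 < p)%N -> M^T = M -> possemidef M ->
  exists2 m, eigenvalue M m & possemidef (m%:M - M).
Proof.
move=> p0 Msym M0; have [u [u0 Mm]] := rayleigh_max M p0.
set m := _ / _ in Mm; exists m => //.
have uu := dot_gt0 u0.
have m0 : 0 <= m by rewrite divr_ge0 ?M0// ltW.
rewrite -Msym; apply/eigenvalue_tr; exists u => //.
have N0 : dot u ((m%:M - M) *m u) = 0.
  by rewrite mulmxBl mul_scalar_mx dotBr dotZr divfK ?subrr// gt_eqF.
(* The constant [m + 1] is positive even if [m = 0], and [(m + 1)%:M - N = 1%:M + M] is positive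
   semidefinite. *)
have := @possemidef_sqr_le (m%:M - M) (m + 1) u.
rewrite N0 mulr0 linearB /= tr_scalar_mx Msym => /(_ erefl Mm) le0.
have : (m%:M - M) *m u = 0.
  apply/eqP; rewrite -dot_eq0 eq_le dot_ge0 andbT le0//; last lra.
  move=> v; rewrite raddfD /= opprB addrC addrA subrK addrC.
  by rewrite mulmxDl mul1mx dotDr addr_ge0 ?M0 ?dot_ge0.
by rewrite mulmxBl mul_scalar_mx => /eqP; rewrite subr_eq0 => /eqP.
Qed.

(** For the top Rayleigh value [m], [|M v|^2 <= m <v, M v> <= m^2 |v|^2], and [m], being an
    eigenvalue, is at most [lambda_max M]. *)
Lemma norm2_mulmx_le M v : M^T = M -> possemidef M ->
  0 <= lambda_max M /\ norm2 (M *m v) <= lambda_max M * norm2 v.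
Proof.
(* In dimension 0 there is no eigenvalue, so [lambda_max] is the default 0 of [sup], and all norms
   vanish. *)
move=> Msym M0; case: (posnP p) => [p0|p0].
  have noI (j : 'I_p) : False by move: (leq_trans (ltn_ord j) (eq_leq p0)).
  have z (w : 'cV[R]_p) : norm2 w = 0.
    by rewrite /norm2 big1 ?sqrtr0// => j; case: (noI j).
  rewrite !z mulr0; split=> //; rewrite /lambda_max (_ : [set _ | _] = set0) ?sup0//.
  apply/seteqP; split=> // a /= /eigenvalueP[u _ /eqP[]].
  by apply/rowP => j; case: (noI j).
have [m mM Mm] := rayleigh_eigenvalue p0 Msym M0.
have /lambda_max_largest[_ /(_ _ mM) mle] : exists a, eigenvalue M a by exists m.
have m0 : 0 <= m.
  move: mM; rewrite -Msym => /eigenvalue_tr[u Mu /dot_gt0 u0].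
  by have := M0 u; rewrite Mu dotZr pmulr_lge0.
split; first exact: le_trans mle.
apply: (@le_trans _ _ (m * norm2 v)); last by rewrite ler_wpM2r ?sqrtr_ge0.
have Mv : dot v (M *m v) <= m * dot v v.
  by rewrite -subr_ge0 -dotZr -dotBr -mul_scalar_mx -mulmxBl.
rewrite !norm2E -[m in leRHS]ger0_norm// -sqrtr_sqr -sqrtrM ?sqr_ge0//.
apply: ler_wsqrtr; rewrite expr2 -mulrA.
have [m_gt0|m_le0] := ltP 0 m.
  by apply: le_trans (possemidef_sqr_le _ Msym M0 Mm m_gt0) _; rewrite ler_pM2l.
(* [possemidef_sqr_le] wants a positive constant. When [m = 0] the form of [M] is nonpositive, so
   the constant 1 serves. *)
have m_eq0 : m = 0 by apply/eqP; rewrite eq_le m_le0 m0.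
move: Mv Mm; rewrite m_eq0 !mul0r => Mv Mm.
apply: le_trans (@possemidef_sqr_le M 1 v Msym M0 _ ltr01) _; last by rewrite mul1r.
move=> w; rewrite mulmxBl mul1mx dotBr subr_ge0; apply: le_trans (dot_ge0 w).
by have := Mm w; rewrite mulmxBl mul_scalar_mx scale0r sub0r -scaleN1r dotZr; lra.
Qed.

End Rayleigh.

(** * The shrinkage matrix of a single data block *)

Section Gram.
Variables (R : realType) (m p : nat) (X : 'M[R]_(m, p)) (rho : R).
Hypotheses (rho_ge0 : 0 <= rho) (reg_unit : reg_gram X rho \in unitmx).

Let c : R := m%:R * rho.

Let c_ge0 : 0 <= c.
Proof. by rewrite mulr_ge0. Qed.

Lemma tr_reg_gram : (reg_gram X rho)^T = reg_gram X rho.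
Proof. by rewrite /reg_gram linearD /= tr_scalar_mx trmx_mul trmxK. Qed.

Lemma dot_gram (w : 'cV[R]_p) :
  dot w (X^T *m X *m w) = dot (X *m w) (X *m w).
Proof. by rewrite -mulmxA dot_mulmxr trmxK. Qed.

Lemma reg_gram_mulmx (w : 'cV[R]_p) :
  reg_gram X rho *m w = X^T *m X *m w + c *: w.
Proof. by rewrite /reg_gram mulmxDl mul_scalar_mx. Qed.

(** With [u = G w], [G] the regularized Gram matrix, [<u, G^-1 u> = |X w|^2 + c |w|^2]. *)
Lemma possemidef_shrinkage : possemidef (c *: invmx (reg_gram X rho)).
Proof.
move=> u; set w := invmx (reg_gram X rho) *m u.
have uE : u = reg_gram X rho *m w by rewrite mulKVmx.
rewrite -scalemxAl -/w dotZr mulr_ge0// uE reg_gram_mulmx dotC dotDr dotZr.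
by rewrite dot_gram addr_ge0 ?mulr_ge0 ?dot_ge0.
Qed.

Lemma dot_shrinkageE (u : 'cV[R]_p) (w := invmx (reg_gram X rho) *m u) :
  dot u u - dot u (c *: invmx (reg_gram X rho) *m u) =
  dot (X^T *m X *m w) (X^T *m X *m w) + c * dot (X *m w) (X *m w).
Proof.
have uE : u = reg_gram X rho *m w by rewrite mulKVmx.
rewrite -scalemxAl -/w dotZr [in LHS]uE reg_gram_mulmx.
rewrite !(dotDl, dotDr, dotZl, dotZr) (dotC _ w) dot_gram.
ring.
Qed.

Lemma dot_shrinkage_le (u : 'cV[R]_p) :
  dot u (c *: invmx (reg_gram X rho) *m u) <= dot u u.
Proof.
by rewrite -subr_ge0 dot_shrinkageE addr_ge0 ?mulr_ge0 ?dot_ge0.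
Qed.

Lemma dot_shrinkage_lt (u : 'cV[R]_p) :
  (forall a : R, eigenvalue (X^T *m X) a -> 0 < a) -> u != 0 ->
  dot u (c *: invmx (reg_gram X rho) *m u) < dot u u.
Proof.
move=> pos u0; rewrite -subr_gt0 dot_shrinkageE.
set w := invmx _ *m u.
have w0 : w != 0.
  by apply: contraNneq u0 => w0; rewrite -(mulKVmx reg_unit u) -/w w0 mulmx0.
rewrite ltr_pwDl ?mulr_ge0 ?dot_ge0// dot_gt0//.
(* A nonzero [w] killed by [X^T *m X] would make 0 an eigenvalue, against [pos]. *)
apply/eqP => Xw0; suff /pos : eigenvalue (X^T *m X) 0 by rewrite ltxx.
rewrite -[X^T *m X]trmxK; apply/eigenvalue_tr; exists w => //.
by rewrite trmx_mul trmxK Xw0 scale0r.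
Qed.

(** Without noise [beta] is a fixed point of the local update, since [G beta = X^T X beta + c beta];
    subtracting leaves only the term in [b - beta]. *)
Lemma local_update_sub (beta b : 'cV[R]_p) :
  local_update X (X *m beta) rho b - beta =
  c *: invmx (reg_gram X rho) *m (b - beta).
Proof.
rewrite /local_update -/c -scalemxAl -[X in _ - X](mulKmx reg_unit) -mulmxBr.
rewrite reg_gram_mulmx scalemxAr mulmxA scalerBr opprD addrACA.
by rewrite subrr add0r.
Qed.

End Gram.

(** * The averaged matrix and the error recursion *)

Section Contraction.
Variables (R : realType) (k p : nat) (n : 'I_k -> nat).
Variables (X : forall i, 'M[R]_(n i, p)) (rho : 'I_k -> R).
Hypotheses (rho_ge0 : forall i, 0 <= rho i).
Hypotheses (reg_unit : forall i, reg_gram (X i) (rho i) \in unitmx).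

Local Notation C := (contraction_mx X rho).

Lemma tr_contraction_mx : C^T = C.
Proof.
rewrite /contraction_mx linearZ linear_sum /=; congr (_ *: _).
by apply: eq_bigr => i _; rewrite linearZ /= trmx_inv tr_reg_gram.
Qed.

Lemma dot_contraction_mx (u : 'cV[R]_p) :
  dot u (C *m u) = k%:R^-1 *
    \sum_i dot u (((n i)%:R * rho i) *: invmx (reg_gram (X i) (rho i)) *m u).
Proof. by rewrite /contraction_mx -scalemxAl dotZr mulmx_suml dot_sumr. Qed.

Lemma possemidef_contraction_mx : possemidef C.
Proof.
move=> u; rewrite dot_contraction_mx mulr_ge0 ?invr_ge0// sumr_ge0// => i _.
exact: possemidef_shrinkage.
Qed.

Lemma lambda_max_contraction_lt1 :
  (exists i, forall a : R, eigenvalue ((X i)^T *m X i) a -> 0 < a) ->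
  lambda_max C < 1.
Proof.
move=> [i0 pos].
have k_gt0 : 0 < k%:R :> R by rewrite ltr0n (leq_ltn_trans _ (ltn_ord i0)).
(* Either [lambda_max C] is itself an eigenvalue, or there is none and it equals 0. *)
have [/lambda_max_largest[+ _]|noev] := pselect (exists a, eigenvalue C a);
    last first.
  rewrite /lambda_max (_ : [set _ | _] = set0) ?sup0//.
  by apply/seteqP; split=> // a Ca; case: noev; exists a.
rewrite -{1}tr_contraction_mx => /eigenvalue_tr[u Cu u0].
rewrite -(ltr_pM2r (dot_gt0 u0)) mul1r -dotZr -Cu dot_contraction_mx.
rewrite mulrC ltr_pdivrMr// mulr_natr -[in ltRHS](card_ord k) -sumr_const.
(* Block [i0] contributes the strict inequality, the others weak ones. *)
rewrite (bigD1 i0)//= [ltRHS](bigD1 i0)//= ltr_leD ?dot_shrinkage_lt//.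
by apply: ler_sum => i _; exact: dot_shrinkage_le.
Qed.

Lemma averaged_update_sub (Y : forall i, 'cV[R]_(n i)) (beta b : 'cV[R]_p) :
  (0 < k)%N -> (forall i, Y i = X i *m beta) ->
  averaged_update X Y rho b - beta = C *m (b - beta).
Proof.
move=> k_gt0 YE; have kn0 : k%:R != 0 :> R by rewrite pnatr_eq0 -lt0n.
rewrite /averaged_update /contraction_mx -scalemxAl mulmx_suml.
have -> : \sum_i ((n i)%:R * rho i) *: invmx (reg_gram (X i) (rho i)) *m (b - beta)
    = \sum_i (local_update (X i) (Y i) (rho i) b - beta).
  by apply: eq_bigr => i _; rewrite YE local_update_sub.
rewrite sumrB sumr_const card_ord scalerBr; congr (_ - _).
by rewrite -(scaler_nat k beta) scalerA mulVf ?scale1r.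
Qed.

End Contraction.

Theorem theorem7p1 (R : realType) (k p : nat) (n : 'I_k -> nat)
    (X : forall i, 'M[R]_(n i, p)) (Y : forall i, 'cV[R]_(n i))
    (beta : 'cV[R]_p) (rho : 'I_k -> R)
    (rho_ge0 : forall i, 0 <= rho i)
    (reg_unit : forall i, reg_gram (X i) (rho i) \in unitmx)
    (noiseless : forall i, Y i = X i *m beta)
    (pos_eigen : exists i, forall a : R,
       eigenvalue ((X i)^T *m X i) a -> 0 < a) :
  [/\ lambda_max (contraction_mx X rho) < 1,
      beta_hat X Y rho t @[t --> \oo] --> beta
    & forall t : nat,
        norm2 (beta_hat X Y rho t - beta)
          <= lambda_max (contraction_mx X rho) ^+ t * norm2 beta].
Proof.
have k_gt0 : (0 < k)%N by case: pos_eigen => i _; rewrite (leq_ltn_trans _ (ltn_ord i)).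
have Csym := tr_contraction_mx X rho.
have C0 := possemidef_contraction_mx rho_ge0 reg_unit.
have lam_lt1 := lambda_max_contraction_lt1 rho_ge0 reg_unit pos_eigen.
(* The vector 0 is a dummy: only the sign of [lambda_max] is extracted. *)
have [lam_ge0 _] := norm2_mulmx_le 0 Csym C0.
set lam := lambda_max _ in lam_lt1 lam_ge0 *.
have bound t : norm2 (beta_hat X Y rho t - beta) <= lam ^+ t * norm2 beta.
  elim: t => [|t IH].
    (* The iteration starts at 0, so the initial error is [- beta] and equality holds. *)
    rewrite expr0 mul1r /beta_hat /= sub0r le_eqVlt; apply/orP; left; apply/eqP.
    by rewrite /norm2; congr Num.sqrt; apply: eq_bigr => j _; rewrite mxE sqrrN.
  rewrite [beta_hat _ _ _ _]iterS (averaged_update_sub reg_unit _ k_gt0 noiseless).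
  apply: le_trans (norm2_mulmx_le _ Csym C0).2 _.
  by rewrite exprS -mulrA ler_wpM2l.
split=> //.
apply/cvgrPdist_le => e e0.
(* The geometric bound tends to 0 because [0 <= lam < 1], and it dominates the sup norm of the
   error. *)
have /cvgrPdist_le /(_ _ e0) : lam ^+ t * norm2 beta @[t --> \oo] --> 0.
  rewrite -[X in _ --> X](mul0r (norm2 beta)); apply: cvgMl.
  by apply: cvg_expr; rewrite ger0_norm.
apply: filterS => t; rewrite sub0r normrN ger0_norm; last first.
  by rewrite mulr_ge0 ?exprn_ge0 ?sqrtr_ge0.
apply: le_trans; rewrite distrC.
exact: le_trans (normr_le_norm2 _) (bound t).
Qed.
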